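(* Let $T>0$. Let $g\colon(0,+\infty)\to(0,+\infty)$ be a continuously differentiable function with bounded derivative on $(0,+\infty)$. Let $a\in L^{1}([0,T])$ satisfy $\int_{0}^{T}a(x)\,dx<0$. Then there exists $\nu_{*}>0$ such that the problem \[ u''+\nu\,a(x)g(u)=0\ \text{ on }(0,T),\qquad\mathscr{B}(u,u')=\underline{0}, \] has no positive solutions for each $0<\nu<\nu_{*}$, where $\mathscr{B}(u,u')=\underline{0}$ denotes either of the two boundary conditions (Neumann or periodic) described in the context.
   Context: The boundary operator is either $\mathscr{B}(u,u')=(u'(0),u'(T))$ (Neumann) or $\mathscr{B}(u,u')=(u(T)-u(0),u'(T)-u'(0))$ (periodic); the statement holds for each of the two choices. A solution is a continuously differentiable function $u\colon[0,T]\to\mathbb{R}$ with $u'$ absolutely continuous, satisfying the equation for a.e. $x\in[0,T]$ and the boundary condition. A positive solution is a solution with $u(x)>0$ for every $x\in[0,T]$. *)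

(* Defs.v *)
From HB Require Import structures.
From mathcomp Require Import all_boot all_order all_algebra.
From mathcomp Require Import all_classical all_reals all_analysis.

Set Implicit Arguments.
Unset Strict Implicit.
Unset Printing Implicit Defensive.

Import Order.TTheory GRing.Theory Num.Theory.
Import numFieldNormedType.Exports.

Local Open Scope classical_set_scope.
Local Open Scope ring_scope.

(* The difference quotient only sees points of A, so that for A = [0, T] this
   is the one-sided derivative at the two endpoints. *)
Definition is_derive_on (R : realType) (A : set R) (f df : R -> R) : Prop :=
  forall x, A x ->
    (fun y : R => (f y - f x) / (y - x)) @ within A x^' --> df x.

(* The index type 'I_n ranges over finite families of pairwise disjoint open
   subintervals ]s i, t i[ of [a, b]; empty ones contribute 0 to both sums. *)
Definition absolutely_continuous_on (R : realType) (a b : R) (f : R -> R)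
    : Prop :=
  forall eps : R, 0 < eps -> exists2 delta : R, 0 < delta &
    forall (n : nat) (s t : 'I_n -> R),
      (forall i, [/\ a <= s i, s i <= t i & t i <= b]) ->
      trivIset [set: 'I_n] (fun i => `]s i, t i[%classic) ->
      \sum_(i < n) (t i - s i) < delta ->
      \sum_(i < n) `|f (t i) - f (s i)| < eps.

Variant boundary_condition := Neumann | Periodic.

Definition boundary_operator (R : realType) (bc : boundary_condition) (T : R)
    (u du : R -> R) : R * R :=
  match bc with
  | Neumann => (du 0, du T)
  | Periodic => (u T - u 0, du T - du 0)
  end.

(* du is the derivative of u on [0, T]; it is uniquely determined there, and
   its values outside [0, T] are irrelevant (the two endpoints, where derive1 du
   would see them, form a null set). *)
Definition is_solution (R : realType) (bc : boundary_condition) (T nu : R)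
    (a g u : R -> R) : Prop :=
  exists du : R -> R,
    [/\ is_derive_on `[0, T] u du,
        {within `[0, T], continuous du},
        absolutely_continuous_on 0 T du,
        {ae @lebesgue_measure R, forall x : R, x \in `[0, T] ->
           derivable du x 1 /\ derive1 du x + nu * a x * g (u x) = 0}
      & boundary_operator bc T u du = (0, 0)].

(* The values of g on ]-oo, 0] are irrelevant for such u. *)
Definition is_positive_solution (R : realType) (bc : boundary_condition)
    (T nu : R) (a g u : R -> R) : Prop :=
  is_solution bc T nu a g u /\ (forall x : R, x \in `[0, T] -> 0 < u x).

(* Main.v *)
(* With z = u' / (nu g(u)) the equation becomes the Riccati equation
   z' = - a - nu g'(u) z^2, either boundary condition gives z(0) = z(T), and z
   vanishes somewhere (at 0, or by Rolle's theorem).  Since g' is bounded, for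
   small nu the quadratic term cannot push |z| beyond 2 ||a||_1 + 1.  Integrating
   over [0, T] then gives - int a = nu int g'(u) z^2 = O(nu), which is impossible
   for small nu.

   Integration is done without a fundamental theorem of calculus for z: with A
   the indefinite integral of a, the function z + A is absolutely continuous and
   its derivative is a.e. bounded by nu K z^2, so only a mean value inequality
   for absolutely continuous functions is needed. *)

Require Import Defs.
From HB Require Import structures.
From mathcomp Require Import all_boot all_order all_algebra.
From mathcomp Require Import all_classical all_reals all_analysis.
From mathcomp Require Import lra ring.

Set Implicit Arguments.
Unset Strict Implicit.
Unset Printing Implicit Defensive.

Import Order.TTheory GRing.Theory Num.Theory.
Import numFieldNormedType.Exports.

Local Open Scope classical_set_scope.
Local Open Scope ring_scope.

(** * Finite families of disjoint intervals, local slopes, and real induction on a segment *)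

Lemma trivIset_lt_itv (R : realType) (n : nat) (s t : nat -> R) :
  (forall i j, (i < j < n)%N -> t i <= s j) ->
  trivIset [set: 'I_n] (fun i : 'I_n => `]s i, t i[%classic).
Proof.
move=> st i j _ _ [x []] /=; rewrite !in_itv /= => /andP[six xti] /andP[sjx xtj].
have [ij|ji|/val_inj//] := ltngtP i j.
- have := st i j; rewrite ij ltn_ord => /(_ isT) tisj.
  by have := lt_trans xti (le_lt_trans tisj sjx); rewrite ltxx.
- have := st j i; rewrite ji ltn_ord => /(_ isT) tjsi.
  by have := lt_trans xtj (le_lt_trans tjsi six); rewrite ltxx.
Qed.

(** Links the total length in [absolutely_continuous_on] to Lebesgue measure, so that it can be
    compared with the measure of an open set or with the domain of an integral. *)
Lemma sum_itv_length (R : realType) (n : nat) (s t : 'I_n -> R) :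
  (forall i, s i <= t i) ->
  trivIset [set: 'I_n] (fun i => `]s i, t i[%classic) ->
  (\sum_(i < n) (t i - s i))%:E =
    (@lebesgue_measure R) (\big[setU/set0]_(i < n) `]s i, t i[%classic).
Proof.
move=> st tr; rewrite measure_semi_additive_ord//; last first.
  by apply: bigsetU_measurable.
rewrite -sumEFin; apply: eq_bigr => i _.
rewrite [RHS]lebesgue_measure_itv /= lte_fin.
have := st i; rewrite le_eqVlt => /predU1P[->|->]; last by rewrite EFinB.
by rewrite ltxx subrr.
Qed.

(** The slack [c' - c] absorbs the error between the difference quotient and the derivative. *)
Lemma derive_near_slope_le (R : realType) (F : R -> R) (x c c' : R) : c < c' ->
  derivable F x 1 -> `|derive1 F x| <= c ->
  exists2 r : R, 0 < r &
    forall y, `|y - x| < r -> `|F y - F x| <= c' * `|y - x|.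
Proof.
move=> cc' dF Fc.
have e0 : 0 < c' - c by rewrite subr_gt0.
have : (fun h => h^-1 *: (F (h *: 1 + x) - F x)) h @[h --> 0^'] --> derive1 F x.
  by rewrite derive1E.
move=> /cvgrPdist_le /(_ _ e0) [r /= r0 H]; exists r => // y yr.
have [->|yx] := eqVneq y x; first by rewrite !subrr normr0 mulr0.
have := H (y - x); rewrite /= sub0r normrN yr subr_eq0 => /(_ isT yx).
rewrite /GRing.scale /= mulr1 subrK => H1.
have yx0 : 0 < `|y - x| by rewrite normr_gt0 subr_eq0.
rewrite -ler_pdivrMr// -normfV -normrM mulrC.
have := ler_distD (derive1 F x) 0 ((y - x)^-1 * (F y - F x)).
rewrite !sub0r !normrN; lra.
Qed.

(** A supremum argument stands in for a compactness argument: endpoints up to which the estimate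
    holds are propagated to the right. Each short step either is stored as an interval inside [U] or
    pays for itself with slope [c]. *)
Lemma real_induction_cover (R : realType) (a b c : R) (F : R -> R) (U : set R) :
  a <= b -> 0 <= c ->
  (forall x, a <= x <= b -> exists2 r : R, 0 < r &
     forall y z, a <= y -> z <= b -> x - r < y -> y <= x -> x <= z -> z < x + r ->
       `[y, z] `<=` U \/ `|F z - F y| <= c * (z - y)) ->
  exists n (s t : nat -> R), [/\
    forall i, (i < n)%N -> [/\ a <= s i, s i <= t i, t i <= b &
       `[s i, t i] `<=` U],
    forall i j, (i < j < n)%N -> t i <= s j &
    `|F b - F a| <= c * (b - a) + \sum_(i < n) `|F (t i) - F (s i)|].
Proof.
move=> ab c0 loc.
pose good x := exists n (s t : nat -> R), [/\
    forall i, (i < n)%N -> [/\ a <= s i, s i <= t i, t i <= x &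
       `[s i, t i] `<=` U],
    forall i j, (i < j < n)%N -> t i <= s j &
    `|F x - F a| <= c * (x - a) + \sum_(i < n) `|F (t i) - F (s i)|].
have good_a : good a.
  exists 0%N, (fun=> 0), (fun=> 0); split => //.
  by rewrite big_ord0 !subrr mulr0 normr0 addr0.
have good_step y z : a <= y -> y <= z -> good y ->
    `[y, z] `<=` U \/ `|F z - F y| <= c * (z - y) -> good z.
  move=> ay yz [n [s [t [st tr Fy]]]] [yzU|Fyz]; last first.
    exists n, s, t; split => // [i /st[? ? ty ?]|].
      by split => //; exact: le_trans yz.
    by have := ler_distD (F y) (F z) (F a); lra.
  (* The interval from [y] to [z] is appended at index [n]; the order is kept because the earlier
     intervals all end at or before [y]. *)
  exists n.+1, (fun i => if i == n then y else s i),
    (fun i => if i == n then z else t i); split.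
  - move=> i; rewrite ltnS leq_eqVlt; case: eqP => //= _ /st[? ? ty ?].
    by split => //; exact: le_trans yz.
  - move=> i j /andP[ij]; rewrite ltnS leq_eqVlt => /predU1P[jn|jn].
      rewrite jn eqxx in ij *; rewrite (ltn_eqF ij).
      by have [] := st _ ij.
    by rewrite (ltn_eqF jn) (ltn_eqF (ltn_trans ij jn)); apply: tr; rewrite ij.
  - rewrite big_ord_recr /= eqxx.
    under eq_bigr => i _ do rewrite (ltn_eqF (ltn_ord i)).
    have := ler_distD (F y) (F z) (F a).
    set S := \sum_(i < n) _ in Fy *.
    have : c * (y - a) <= c * (z - a) by rewrite ler_wpM2l// lerB.
    lra.
pose S := [set x | a <= x <= b /\ good x].
have Sa : S a by split => //; rewrite lexx.
have supS : has_sup S by split; [exists a|exists b => x [/andP[]]].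
have aS : a <= sup S by exact: sup_upper_bound.
have Sb : sup S <= b by apply: sup_le_ub; [exists a|move=> x [/andP[]]].
have [|r r0 H] := loc (sup S); first by rewrite aS.
(* A good [y] lies within [r] to the left of the supremum. A single local step then leads from [y]
   to a point [z] beyond the supremum, which is possible only if the supremum is already [b]. *)
have [y [/andP[ay yb] gy] ySr] := sup_adherent r0 supS.
have yS : y <= sup S by apply: sup_upper_bound => //; split => //; rewrite ay.
pose z := Num.min b (sup S + r / 2).
have Sz : sup S <= z by rewrite le_min Sb lerDl divr_ge0// ltW.
have zb : z <= b by rewrite ge_min lexx.
have gz : good z.
  apply: (good_step y) => //; first exact: le_trans Sz.
  apply: H => //.
  by rewrite gt_min ltrD2l ltr_pdivrMr// ltr_pMr// ltr1n orbT.
have zS : z <= sup S.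
  by apply: sup_upper_bound => //; split => //; rewrite zb (le_trans aS).
have zbE : z = b.
  move: zS; rewrite ge_min => /orP[bS|]; last by rewrite gerDl leNgt divr_gt0.
  by apply/eqP; rewrite eq_le zb (le_trans bS).
by move: gz; rewrite zbE.
Qed.

(** * Absolutely continuous functions: closure properties and a mean value inequality *)

Lemma ac_sub (R : realType) (a b a' b' : R) (F : R -> R) :
  a <= a' -> b' <= b ->
  absolutely_continuous_on a b F -> absolutely_continuous_on a' b' F.
Proof.
move=> aa' bb' acF e /acF[d d0 H]; exists d => // n s t st; apply: H => i.
have [? ? ?] := st i; split => //; [exact: le_trans aa' _|exact: le_trans bb'].
Qed.

Lemma acD (R : realType) (a b : R) (F G : R -> R) :
  absolutely_continuous_on a b F -> absolutely_continuous_on a b G ->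
  absolutely_continuous_on a b (fun x => F x + G x).
Proof.
move=> acF acG e e0; have e20 : 0 < e / 2 by rewrite divr_gt0.
have [d d0 HF] := acF _ e20; have [d' d'0 HG] := acG _ e20.
exists (Num.min d d'); first by rewrite lt_min d0.
move=> n s t st tr; rewrite lt_min => /andP[/HF{}HF /HG{}HG].
have {}HF := HF st tr; have {}HG := HG st tr.
rewrite (splitr e); apply: le_lt_trans (ltrD HF HG).
rewrite -big_split /=; apply: ler_sum => i _.
by rewrite opprD addrACA ler_normD.
Qed.

Lemma acM (R : realType) (a b M N : R) (F G : R -> R) :
  (forall x, a <= x <= b -> `|F x| <= M) ->
  (forall x, a <= x <= b -> `|G x| <= N) ->
  absolutely_continuous_on a b F -> absolutely_continuous_on a b G ->
  absolutely_continuous_on a b (fun x => F x * G x).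
Proof.
move=> FM GN acF acG e e0.
(* A common bound for both factors; the added 1 keeps it positive, so that division by it is
   safe. *)
pose C := `|M| + `|N| + 1.
have C0 : 0 < C by rewrite ltr_pwDr// addr_ge0.
have e20 : 0 < e / (2 * C) by rewrite divr_gt0// mulr_gt0.
have [d d0 HF] := acF _ e20; have [d' d'0 HG] := acG _ e20.
exists (Num.min d d'); first by rewrite lt_min d0.
move=> n s t st tr; rewrite lt_min => /andP[/HF{}HF /HG{}HG].
have {}HF := HF st tr; have {}HG := HG st tr.
have -> : e = C * (e / (2 * C) + e / (2 * C)) by field; lra.
apply: le_lt_trans (_ : _ <= C * (_ + _)) _; last first.
  by rewrite ltr_pM2l//; exact: ltrD HF HG.
rewrite -big_split /= mulr_sumr; apply: ler_sum => i _.
have [asi sti tib] := st i.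
have FC : `|F (s i)| <= C.
  have := FM (s i); rewrite asi (le_trans sti)// => /(_ isT).
  by have := ler_norm M; have := normr_ge0 N; rewrite /C; lra.
have GC : `|G (t i)| <= C.
  have := GN (t i); rewrite tib (le_trans asi)// => /(_ isT).
  by have := ler_norm N; have := normr_ge0 M; rewrite /C; lra.
have -> : F (t i) * G (t i) - F (s i) * G (s i) =
    (F (t i) - F (s i)) * G (t i) + F (s i) * (G (t i) - G (s i)) by ring.
rewrite (le_trans (ler_normD _ _))// !normrM mulrDr.
by apply: lerD; [rewrite mulrC|]; exact: ler_wpM2r.
Qed.

Lemma lipschitz_ac (R : realType) (a b L : R) (F : R -> R) :
  (forall x y, a <= x -> x <= y -> y <= b -> `|F y - F x| <= L * (y - x)) ->
  absolutely_continuous_on a b F.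
Proof.
move=> FL e e0; have L0 : 0 < `|L| + 1 by rewrite ltr_pwDr.
exists (e / (`|L| + 1)); first by rewrite divr_gt0.
move=> n s t st tr; rewrite ltr_pdivlMr// => H; apply: le_lt_trans H.
rewrite mulr_suml; apply: ler_sum => i _; have [asi sti tib] := st i.
apply: le_trans (FL _ _ asi sti tib) _; rewrite mulrC ler_wpM2l ?subr_ge0//.
by have := ler_norm L; lra.
Qed.

(* The points where the derivative bound fails lie in an open set of measure less
   than the delta of absolute continuity, so they contribute at most epsilon. *)
Lemma ac_derive_le (R : realType) (a b c : R) (F : R -> R) :
  a <= b -> 0 <= c -> absolutely_continuous_on a b F ->
  {ae @lebesgue_measure R, forall x, a < x < b ->
    derivable F x 1 /\ `|derive1 F x| <= c} ->
  `|F b - F a| <= c * (b - a).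
Proof.
move=> ab c0 acF [B [mB B0 PB]].
apply/ler_addgt0Pr => e e0.
have ba0 : 0 < b - a + 1 by rewrite ltr_wpDl// subr_ge0.
(* Chosen so that the excess slope costs [k * (b - a)], the exceptional intervals cost [k], and
   together these make exactly [e]. *)
pose k := e / (b - a + 1).
have k0 : 0 < k by rewrite divr_gt0.
have [d d0 H] := acF _ k0.
(* The endpoints join the exceptional null set because the derivative is controlled only at interior
   points. *)
pose B' := B `|` [set a] `|` [set b].
have mB' : measurable B' by apply: measurableU => //; exact: measurableU.
have B'0 : (@lebesgue_measure R) B' = 0%E.
  have set1_0 x := @lebesgue_measure_set1 R x.
  have mBa : measurable (B `|` [set a]) by exact: measurableU.
  apply: etrans (measureU0 mBa _ (set1_0 b)) _ => //.
  exact: etrans (measureU0 mB _ (set1_0 a)) B0.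
have [|U [oU BU UB]] := lebesgue_regularity_outer mB' _ d0.
  by rewrite [ltLHS]B'0 ltry.
have mU : measurable U by exact: measurable_realfun.open_measurable.
(* Outer regularity bounds the measure of [U] minus [B']; as [B'] is null, the same bound holds for
   [U]. *)
have Ud : (@lebesgue_measure R U < d%:E)%E.
  by rewrite -(setDUK BU) setUC measureU0//; exact: measurableD.
have ck0 : 0 <= c + k by rewrite addr_ge0// ltW.
have [x /andP[ax xb]|n [s [t [st tr Fab]]]] :=
    @real_induction_cover R a b (c + k) F U ab ck0.
  have [B'x|nB'x] := pselect (B' x).
    have /= [r r0 rU] : nbhs x U by apply: open_nbhs_nbhs; split => //; exact: BU.
    exists r => // y z ay zb xy yx xz zx; left => w /=.
    rewrite in_itv /= => /andP[yw wz]; apply: rU => /=.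
    by rewrite ltr_distl; apply/andP; split; lra.
  have axb : a < x < b.
    rewrite !lt_neqAle ax xb !andbT; apply/andP; split; apply/eqP => xE.
      by apply: nB'x; left; right.
    by apply: nB'x; right.
  have [dF Fc] : derivable F x 1 /\ `|derive1 F x| <= c.
    by apply: contrapT => nP; apply: nB'x; left; left; apply: PB => /(_ axb).
  (* Since [y] and [z] lie on opposite sides of [x], the slope estimates from [x] to each of them
     add up to one from [y] to [z]. *)
  have [|r r0 rF] := derive_near_slope_le _ dF Fc (c' := c + k).
    by rewrite ltrDl.
  exists r => // y z ay zb xy yx xz zx; right.
  have yE : `|y - x| = x - y by rewrite distrC ger0_norm// subr_ge0.
  have zE : `|z - x| = z - x by rewrite ger0_norm// subr_ge0.
  have [yr zr] : x - y < r /\ z - x < r by split; lra.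
  have := rF y; rewrite yE yr => /(_ isT) Fy.
  have := rF z; rewrite zE zr => /(_ isT) Fz.
  have := ler_distD (F x) (F z) (F y); rewrite (distrC (F x) (F y)).
  have -> : (c + k) * (z - y) = (c + k) * (z - x) + (c + k) * (x - y) by ring.
  lra.
have st' i : (i < n)%N -> s i <= t i by move=> /st[].
have tr' := @trivIset_lt_itv R n s t tr.
have Fst : \sum_(i < n) `|F (t i) - F (s i)| < k.
  apply: H => // [i|]; first by have [] := st i (ltn_ord i).
  rewrite -lte_fin sum_itv_length//; last by move=> i; exact: st'.
  apply: le_lt_trans Ud; apply: le_measure; rewrite ?inE//.
    exact: bigsetU_measurable.
  rewrite -(bigcup_mkord n (fun i => `]s i, t i[%classic)) => x [i /= ilt] sxt.
  by have [_ _ _] := st i ilt; apply; exact: subset_itv_oo_cc sxt.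
apply: le_trans Fab _; have -> : e = k * (b - a) + k by rewrite /k; field; lra.
lra.
Qed.

(** * The indefinite integral of an integrable function *)

Section indefinite_integral.
Context {R : realType}.
Notation mu := (@lebesgue_measure R).
Variable f : R -> R.
Hypothesis intf : mu.-integrable [set: R] (EFin \o f).
Let A (x : R) := \int[mu]_(t in `]-oo, x]) f t.

Let intn : mu.-integrable [set: R] (EFin \o (fun x => `|f x|)).
Proof. exact: (@integrable_norm _ _ _ mu _ f). Qed.

Let intfS (D : set R) (g : R -> R) : mu.-integrable [set: R] (EFin \o g) ->
  measurable D -> mu.-integrable D (EFin \o g).
Proof. by move=> ig mD; exact: integrableS ig. Qed.

Lemma indefinite_integral_dist (x y : R) : x <= y ->
  `|A y - A x| <= \int[mu]_(t in `]x, y[) `|f t|.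
Proof.
move=> xy; rewrite /A Rintegral_itvB//; last exact: intfS.
rewrite -Rintegral_itv_bndo_bndc; last exact: intfS.
by apply: le_normr_Rintegral => //; exact: intfS.
Qed.

(** The increments sum to at most the integral of [|f|] over the union of the intervals, which is
    small when the measure of that union is small. *)
Lemma indefinite_integral_ac (a b : R) : absolutely_continuous_on a b A.
Proof.
move=> e e0; have [d [d0 H]] := integral_normr_continuous intf e0.
exists d => // n s t st tr std.
have mI : measurable (\big[setU/set0]_(i < n) `]s i, t i[%classic).
  exact: bigsetU_measurable.
apply: le_lt_trans (H _ mI _); last first.
  by move: std; rewrite -lte_fin sum_itv_length// => i; have [] := st i.
rewrite -lee_fin -sumEFin [leRHS]fineK; last first.
  by apply: integrable_fin_num => //; exact: intfS.
rewrite ge0_integral_bigsetU//; last 3 first.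
- exact: index_enum_uniq.
- exact: sub_trivIset tr.
- by have /integrableP[] := intfS intn mI.
apply: lee_sum => i _; have [_ sti _] := st i.
rewrite -[leRHS]fineK; last by apply: integrable_fin_num => //; exact: intfS.
by rewrite lee_fin; exact: indefinite_integral_dist.
Qed.

Lemma indefinite_integral_ae_derive :
  {ae mu, forall x, derivable A x 1 /\ derive1 A x = f x}.
Proof.
apply: FTC1Ny; first by move=> y; exact: intfS.
by apply: open_integrable_locally => //; exact: openT.
Qed.

(** Supplies the constant [L] of the Riccati estimate, uniform in both points. *)
Lemma indefinite_integral_dist_le (x y : R) :
  `|A y - A x| <= \int[mu]_t `|f t|.
Proof.
wlog xy : x y / x <= y.
  by move=> H; have [/H//|/ltW/H] := leP x y; rewrite distrC.
apply: le_trans (indefinite_integral_dist xy) _.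
rewrite fine_le//; [| |].
- by apply: integrable_fin_num => //; exact: intfS.
- by apply: integrable_fin_num => //; exact: intfS.
apply: ge0_subset_integral => //.
by have /integrableP[] := intn.
Qed.

End indefinite_integral.

(** * Reciprocals, continuity and boundedness on a segment *)

Lemma acV (R : realType) (a b m : R) (F : R -> R) :
  0 < m -> (forall x, a <= x <= b -> m <= F x) ->
  absolutely_continuous_on a b F ->
  absolutely_continuous_on a b (fun x => (F x)^-1).
Proof.
move=> m0 mF acF e e0; have m2 : 0 < m * m by rewrite mulr_gt0.
have [|d d0 H] := acF (m * m * e); first by rewrite mulr_gt0.
exists d => // n s t st tr /(H _ _ _ st tr){}H.
rewrite -(ltr_pM2l m2); apply: le_lt_trans H; rewrite mulr_sumr.
apply: ler_sum => i _; have [asi sti tib] := st i.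
have Fs : m <= F (s i) by apply: mF; rewrite asi (le_trans sti).
have Ft : m <= F (t i) by apply: mF; rewrite tib (le_trans asi).
have [Fs0 Ft0] : 0 < F (s i) /\ 0 < F (t i) by split; lra.
(* The denominator in this identity is at least [m * m], which explains the factor in the choice of
   [d]. *)
have -> : (F (t i))^-1 - (F (s i))^-1 =
    - (F (t i) - F (s i)) / (F (t i) * F (s i)).
  by field; rewrite !gt_eqF.
rewrite normrM normrN normfV [`|_ * F (s i)|]gtr0_norm ?mulr_gt0//.
rewrite mulrCA ler_piMr// ler_pdivrMr ?mulr_gt0// mul1r.
by apply: ler_pM => //; exact: ltW.
Qed.

Lemma ac_continuous (R : realType) (a b : R) (F : R -> R) :
  absolutely_continuous_on a b F -> {within `[a, b], continuous F}.
Proof.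
move=> acF; apply/subspace_continuousP => x /=; rewrite in_itv /= => /andP[ax xb].
apply/cvgrPdist_lt => e e0; have [d d0 H] := acF _ e0.
have {}H y z : a <= y -> y <= z -> z <= b -> z - y < d -> `|F z - F y| < e.
  move=> ay yz zb zyd.
  have := H 1%N (fun=> y) (fun=> z); rewrite !big_ord1; apply => //.
  by move=> i j _ _ _; rewrite !ord1.
exists d => //= y; rewrite in_itv /= => yxd /andP[ay yb].
have [xy|/ltW yx] := leP x y.
  by rewrite distrC; apply: H => //; move: yxd; rewrite ltr_distl; lra.
by apply: H => //; move: yxd; rewrite ltr_distl; lra.
Qed.

Lemma continuous_bounded_itv (R : realType) (a b : R) (F : R -> R) : a <= b ->
  {within `[a, b], continuous F} ->
  exists M, forall x, a <= x <= b -> `|F x| <= M.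
Proof.
move=> ab cF.
have cnF : {within `[a, b], continuous (fun x => `|F x|)}.
  apply/subspace_continuousP => x xab.
  by apply: cvg_norm; move/subspace_continuousP : cF; exact.
have [c _ H] := EVT_max ab cnF.
by exists `|F c| => x xab; apply: H; rewrite in_itv.
Qed.

(** * Derivatives relative to a segment *)

Section derive_on.
Context {R : realType}.
Variables (a b : R) (u du : R -> R).
Hypothesis udu : is_derive_on `[a, b] u du.

Lemma derive_on_is_derive (x : R) : a < x < b -> is_derive x 1 u (du x).
Proof.
move=> /andP[ax xb].
have /udu H : x \in `[a, b] by rewrite in_itv /= !ltW.
have cv : (fun h => h^-1 *: (u (h *: 1 + x) - u x)) h @[h --> 0^'] --> du x.
  apply/cvgrPdist_lt => e e0; move/cvgrPdist_lt : H => /(_ _ e0) [d /= d0 H].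
  (* The two extra bounds keep [h + x] inside the segment, where the relative difference quotient is
     controlled. *)
  exists (Num.min d (Num.min (x - a) (b - x))) => /=.
    by rewrite !lt_min d0 !subr_gt0 ax.
  move=> h /=; rewrite sub0r normrN !lt_min => /and3P[hd ha hb] h0.
  have := H (h + x); rewrite /= distrC addrK => /(_ hd).
  rewrite -subr_eq0 addrK => /(_ h0).
  rewrite /GRing.scale /= mulr1 [_^-1 * _]mulrC; apply.
  by rewrite in_itv /=; move: ha hb; rewrite !ltr_norml; lra.
by apply: DeriveDef; [apply/cvg_ex; exists (du x)|exact: cvg_lim].
Qed.

Lemma derive_on_continuous : {within `[a, b], continuous u}.
Proof.
apply/subspace_continuousP => x xab; have /udu H := xab.
apply/cvgrPdist_lt => e e0.
(* Tolerance 1 suffices: near [x] the difference quotient is at most [|du x| + 1] in absolute value,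
   a local Lipschitz bound at [x]. *)
move/cvgrPdist_lt : H => /(_ 1 ltr01) [d /= d0 H].
have C0 : 0 < `|du x| + 1 by rewrite ltr_pwDr.
exists (Num.min d (e / (`|du x| + 1))) => /=.
  by rewrite lt_min d0 divr_gt0.
move=> y /=; rewrite lt_min ltr_pdivlMr// => /andP[yd ye] yab.
have [->|yx] := eqVneq y x; first by rewrite subrr normr0.
have := H y yd yx yab => {}H; rewrite distrC; apply: le_lt_trans ye.
have yx0 : 0 < `|y - x| by rewrite normr_gt0 subr_eq0.
rewrite (distrC x) mulrC -ler_pdivrMr// -normfV -normrM.
have := ler_distD (du x) 0 ((u y - u x) / (y - x)).
by rewrite !sub0r !normrN; lra.
Qed.

Lemma derive_on_lipschitz (M : R) :
  (forall x, a <= x <= b -> `|du x| <= M) ->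
  forall x y, a <= x -> x <= y -> y <= b -> `|u y - u x| <= M * (y - x).
Proof.
move=> duM x y ax xy yb.
have sub : `[x, y] `<=` `[a, b].
  by apply: subset_itv; rewrite bnd_simp.
have [||c + ->] := @MVT_segment _ u du x y xy.
- move=> z; rewrite in_itv /= => /andP[xz zy]; apply: derive_on_is_derive.
  by apply/andP; split; lra.
- exact: continuous_subspaceW sub derive_on_continuous.
rewrite in_itv /= => /andP[xc cy].
rewrite normrM [`|y - x|]ger0_norm ?subr_ge0// ler_wpM2r ?subr_ge0//.
by apply: duM; apply/andP; split; lra.
Qed.

End derive_on.

(** * A priori bound for the Riccati inequality *)

Section riccati.
Context {R : realType}.
Variables (T k L : R) (z A : R -> R).
Hypothesis T0 : 0 < T.
Hypothesis k0 : 0 <= k.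
Hypothesis z_ac : absolutely_continuous_on 0 T z.
Hypothesis A_ac : absolutely_continuous_on 0 T A.
Hypothesis A_le : forall x y, `|A y - A x| <= L.
Hypothesis zA : {ae @lebesgue_measure R, forall x, 0 < x < T ->
  [/\ derivable z x 1, derivable A x 1 &
      `|derive1 z x + derive1 A x| <= k * z x ^+ 2]}.

(** While [|z|] stays below [M], the derivative of [z + A] is a.e. at most [k * M ^+ 2] in absolute
    value, so the mean value inequality for absolutely continuous functions applies. *)
Let riccati_le (M s t : R) : 0 <= s -> s <= t -> t <= T ->
  (forall x, s < x < t -> `|z x| <= M) ->
  `|(z t + A t) - (z s + A s)| <= k * M ^+ 2 * (t - s).
Proof.
move=> s0 st tT zM; apply: (@ac_derive_le _ _ _ _ (fun x => z x + A x)) => //.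
- by rewrite mulr_ge0// sqr_ge0.
- by apply: acD; [exact: ac_sub z_ac|exact: ac_sub A_ac].
move: zA; apply: filterS.
  exact: (ae_filter_ringOfSetsType (@lebesgue_measure R)).
move=> x H /andP[sx xt].
have [|dz dA zAx] := H; first by apply/andP; split; lra.
split; first exact: derivableD.
rewrite derive1E deriveD// -!derive1E; apply: le_trans zAx _.
rewrite ler_wpM2l//.
have := zM x; rewrite sx xt => /(_ isT) zxM.
by rewrite -real_normK ?num_real// lerXn2r// nnegrE; exact: le_trans zxM.
Qed.

(* If |z| reached M = 2 L + 1, then at a point t nearest to t0 where |z t| >= M
   one has |z| < M between t0 and t, hence M <= |z t| <= k M^2 T + L < M. *)
Lemma riccati_bound (t0 : R) : 0 <= t0 <= T -> z t0 = 0 ->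
  k * (2 * L + 1) ^+ 2 * T < L + 1 ->
  `|(z T + A T) - (z 0 + A 0)| <= k * (2 * L + 1) ^+ 2 * T.
Proof.
move=> /andP[t00 t0T] zt0 kLT; set M := 2 * L + 1 in kLT *.
have L0 : 0 <= L by apply: le_trans (A_le 0 0).
have M0 : 0 < M by rewrite /M; lra.
have kM0 : 0 <= k * M ^+ 2 by rewrite mulr_ge0// sqr_ge0.
have zM x : 0 <= x <= T -> `|z x| < M.
  move=> xT; rewrite ltNge; apply/negP => Mzx.
  pose S := [set t | t \in `[0, T] /\ M <= `|z t|].
  have Sx : S x by split => //; rewrite in_itv.
  have ST : S `<=` `[0, T] by move=> ? [].
  have clS : closed S.
    move=> t clSt.
    have tT : t \in `[0, T].
      have : closure `[0, T] t by exact: closureS clSt.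
      by rewrite -(closure_id `[0, T]).1//; exact: itv_closed.
    split => //; rewrite leNgt; apply/negP => ztM.
    (* If [|z t| < M], continuity would force [|z s| < M] at some point [s] of [S] close to [t]. *)
    have /subspace_continuousP /(_ _ tT) /cvgrPdist_lt := ac_continuous z_ac.
    move=> /(_ (M - `|z t|)); rewrite subr_gt0 => /(_ ztM) nbt.
    have [s [[sT Ms] /= zs]] := clSt _ nbt.
    have {}zs := zs sT.
    by have := ler_dist_dist (z t) (z s); have := ler_norm (`|z s| - `|z t|);
      rewrite (distrC `|z s|); lra.
  have cS : compact S.
    by apply: subclosed_compact clS _ ST; exact: segment_compact.
  (* Maximizing minus the distance to [t0] over the compact set [S] selects a point of [S] nearest
     to [t0]. *)
  have cd : {within S, continuous (fun t => - `|t - t0|)}.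
    apply: continuous_subspaceT => t; apply: cvgN.
    apply: cvg_norm; apply: cvgB; [exact: cvg_id|exact: cvg_cst].
  have [|t /set_mem[]] := compact_EVT_max _ cS cd; first by exists x.
  rewrite in_itv /= => /andP[t_ge0 tT] Mzt tmin.
  have near_t0 s : 0 <= s -> s <= T -> `|s - t0| < `|t - t0| -> `|z s| <= M.
    move=> s0 sT st; rewrite leNgt; apply/negP => Ms.
    have sS : s \in S by rewrite inE; split; [rewrite in_itv /= s0|exact: ltW].
    by have := tmin _ sS; rewrite lerN2 leNgt st.
  have : `|(z t + A t) - (z t0 + A t0)| <= k * M ^+ 2 * T.
    have [t0t|/ltW tt0] := leP t0 t.
      apply: le_trans (@riccati_le M _ _ t00 t0t tT _) _; last first.
        by rewrite ler_wpM2l//; lra.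
      move=> s /andP[t0s st]; apply: near_t0; [lra|lra|].
      by rewrite !gtr0_norm ?subr_gt0//; lra.
    rewrite distrC.
    apply: le_trans (@riccati_le M _ _ t_ge0 tt0 t0T _) _; last first.
      by rewrite ler_wpM2l//; lra.
    move=> s /andP[ts st0]; apply: near_t0; [lra|lra|].
    by rewrite !ltr0_norm ?subr_lt0//; lra.
  (* As [z t0 = 0], removing the increment of [A] costs at most [L], so [|z t| < (L + 1) + L = M],
     against the choice of [t]. *)
  have := A_le t0 t; have := ler_normD ((z t + A t) - (z t0 + A t0)) (A t0 - A t).
  have -> : z t + A t - (z t0 + A t0) + (A t0 - A t) = z t by rewrite zt0; ring.
  by rewrite (distrC (A t0)) => ? ? ?; have : M = 2 * L + 1 by []; lra.
have := @riccati_le M 0 T (lexx 0) (ltW T0) (lexx T); rewrite subr0; apply.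
by move=> x /andP[x0 xT]; apply: ltW; apply: zM; rewrite !ltW.
Qed.

End riccati.

(** * The nonlinearity, the boundary conditions and the Riccati quotient *)

Lemma derive_bounded_lipschitz_gt0 (R : realType) (g : R -> R) (K : R) :
  (forall s, 0 < s -> derivable g s 1) ->
  (forall s, 0 < s -> `|derive1 g s| <= K) ->
  forall p q, 0 < p -> 0 < q -> `|g q - g p| <= K * `|q - p|.
Proof.
move=> dg gK p q; wlog pq : p q / p <= q.
  move=> H p0 q0; have [/H|/ltW/H] := leP p q; first exact.
  by rewrite distrC (distrC q); exact.
move=> p0 q0.
have dgp z : z \in `]p, q[ -> is_derive z 1 g (derive1 g z).
  rewrite in_itv /= => /andP[pz _]; rewrite derive1E; apply: derivableP.
  by apply: dg; exact: lt_trans pz.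
have [|c + ->] := MVT_segment pq dgp.
  apply: derivable_within_continuous => z; rewrite in_itv /= => /andP[pz _].
  by apply: dg; exact: lt_le_trans pz.
rewrite in_itv /= => /andP[pc _]; rewrite normrM ler_wpM2r//.
by apply: gK; exact: lt_le_trans pc.
Qed.

Lemma boundary_operator0_zero (R : realType) (bc : boundary_condition) (T : R)
    (u du : R -> R) : 0 < T ->
  is_derive_on `[0, T] u du -> boundary_operator bc T u du = (0, 0) ->
  exists2 t0, 0 <= t0 <= T & du t0 = 0.
Proof.
move=> T0 udu; case: bc => /= -[].
  by move=> du0 _; exists 0; rewrite ?lexx ?ltW.
move=> /eqP; rewrite subr_eq0 => /eqP uT _.
have [||c + cu] := Rolle T0 _ (derive_on_continuous udu).
- move=> x; rewrite in_itv /= => xT.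
  by have [] := derive_on_is_derive udu xT.
- by rewrite uT.
rewrite in_itv /= => cT; exists c; first by have /andP[] := cT; lra.
by have [_ <-] := derive_on_is_derive udu cT; rewrite derive_val.
Qed.

(** With [w s = (nu * g s)^-1] this is [z T = z 0]: both sides vanish in the Neumann case, and the
    factors agree in the periodic case. *)
Lemma boundary_operator0_quotient (R : realType) (bc : boundary_condition)
    (T : R) (u du w : R -> R) : boundary_operator bc T u du = (0, 0) ->
  du T * w (u T) = du 0 * w (u 0).
Proof.
case: bc => /= -[]; first by move=> -> ->; rewrite !mul0r.
by move=> /eqP; rewrite subr_eq0 => /eqP-> /eqP; rewrite subr_eq0 => /eqP->.
Qed.

Lemma is_derive_inv (R : realType) (f : R -> R) (x df : R) :
  is_derive x 1 f df -> f x != 0 ->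
  is_derive x 1 (fun y => (f y)^-1) (- (f x) ^- 2 * df).
Proof.
move=> [fdf <-] fx0; apply: DeriveDef; first exact: derivableV.
exact: deriveV.
Qed.

(** By the equation, [u'' / (nu g(u))] equals [- ax]; differentiating the reciprocal contributes
    [- nu g'(u) u'^2 / (nu g(u))^2], which is the quadratic term. *)
Lemma derive_quotient (R : realType) (nu ax x : R) (g u du : R -> R) :
  0 < nu -> 0 < g (u x) -> is_derive x 1 u (du x) -> derivable g (u x) 1 ->
  derivable du x 1 -> derive1 du x + nu * ax * g (u x) = 0 ->
  is_derive x 1 (fun y => du y * (nu * g (u y))^-1)
    (- ax - nu * derive1 g (u x) * (du x * (nu * g (u x))^-1) ^+ 2).
Proof.
move=> nu0 g0 ux dg ddu ode.
have dgu : is_derive (u x) 1 g (derive1 g (u x)).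
  by rewrite derive1E; exact: derivableP.
have dduE : is_derive x 1 du (- (nu * ax * g (u x))).
  apply: is_derive_eq; first exact: derivableP.
  by rewrite -derive1E; lra.
have cmp : is_derive x 1 (fun y => g (u y)) (derive1 g (u x) * du x).
  exact: is_derive1_comp.
have nucmp : is_derive x 1 (fun y => nu * g (u y))
    (nu * (derive1 g (u x) * du x)).
  exact: (is_deriveZ nu).
have ng0 : nu * g (u x) != 0 by rewrite mulf_neq0// gt_eqF.
have inv := is_derive_inv nucmp ng0.
apply: is_derive_eq (is_deriveM dduE inv) _.
rewrite /GRing.scale /=; field.
by rewrite !gt_eqF.
Qed.

(** * Nonexistence for small [nu] *)

Theorem proposition3p1 (R : realType) (bc : boundary_condition) (T : R)
  (hT : 0 < T) (g : R -> R)
  (g_gt0 : forall s : R, 0 < s -> 0 < g s)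
  (g_derivable : forall s : R, 0 < s -> derivable g s 1)
  (dg_continuous : forall s : R, 0 < s -> {for s, continuous (derive1 g)})
  (dg_bounded : exists K : R, forall s : R, 0 < s -> `|derive1 g s| <= K)
  (a : R -> R)
  (a_L1 : (@lebesgue_measure R).-integrable `[0, T] (EFin \o a))
  (a_mean : (\int[@lebesgue_measure R]_(x in `[0%R, T]) (a x)%:E < 0)%E) :
  exists2 nu_star : R, 0 < nu_star &
    forall nu : R, 0 < nu < nu_star ->
      ~ exists u : R -> R, is_positive_solution bc T nu a g u.
Proof.
move: dg_bounded => [K0 gK0]; pose K := `|K0|.
have gK s : 0 < s -> `|derive1 g s| <= K.
  by move=> /gK0 /le_trans; apply; exact: ler_norm.
have K_ge0 : 0 <= K by exact: normr_ge0.
(* Extension by zero lets [A] integrate over half-lines; [L] is then the L1 norm of [a] on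
   [[0, T]]. *)
pose f := a \_ `[0, T].
have intf : (@lebesgue_measure R).-integrable [set: R] (EFin \o f).
  by rewrite -restrict_EFin; apply/(integrable_mkcond _ _).1.
pose A (x : R) := \int[@lebesgue_measure R]_(t in `]-oo, x]) f t.
pose L := \int[@lebesgue_measure R]_t `|f t|.
have L0 : 0 <= L by exact: Rintegral_ge0.
have A0T : A T - A 0 < 0.
  have intfS D : measurable D ->
      (@lebesgue_measure R).-integrable D (EFin \o f).
    by move=> mD; exact: integrableS intf.
  rewrite /A Rintegral_itvB//; last 2 first.
  - exact: intfS.
  - by rewrite bnd_simp ltW.
  rewrite Rintegral_itv_obnd_cbnd//; last exact: intfS.
  rewrite -lte_fin fineK; last by apply: integrable_fin_num => //; exact: intfS.
  rewrite [ltLHS](_ : _ =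
    (\int[@lebesgue_measure R]_(x in `[0%R, T]) (a x)%:E)%E)//.
  by apply: eq_integral => x xT; rewrite /f patchE xT.
(* [nu * C] dominates the Riccati bound [nu * K * (2 * L + 1) ^+ 2 * T]; the added 1 makes [C]
   positive even when [K = 0]. *)
pose C := K * (2 * L + 1) ^+ 2 * T + 1.
have C0 : 0 < C.
  by rewrite ltr_wpDl// mulr_ge0 ?(ltW hT)// mulr_ge0// sqr_ge0.
(* The bound [L + 1] meets the smallness condition of [riccati_bound]; the bound [A 0 - A T], which
   is minus the integral of [a], yields the final contradiction. *)
exists (Num.min (L + 1) (A 0 - A T) / C).
  by rewrite divr_gt0// lt_min; apply/andP; split; lra.
move=> nu /andP[nu0]; rewrite ltr_pdivlMr// lt_min => /andP[nuL nuA].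
move=> [u [[du [udu du_cont du_ac ode bc0]] u_gt0]].
have {}u_gt0 x : 0 <= x <= T -> 0 < u x.
  by move=> xT; apply: u_gt0; rewrite in_itv.
have [D duD] := continuous_bounded_itv (ltW hT) du_cont.
have u_lip := derive_on_lipschitz udu duD.
have gu_lip x y : 0 <= x -> x <= y -> y <= T ->
    `|g (u y) - g (u x)| <= K * D * (y - x).
  move=> x0 xy yT.
  have [ux uy] : 0 < u x /\ 0 < u y.
    by split; apply: u_gt0; apply/andP; split; lra.
  apply: le_trans (derive_bounded_lipschitz_gt0 g_derivable gK ux uy) _.
  by rewrite -mulrA ler_wpM2l// u_lip.
have gu_ac := lipschitz_ac gu_lip.
(* The minimum of [g (u x)] is positive, so [nu * g (u x)] stays away from 0 and its reciprocal is
   bounded and absolutely continuous. *)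
have [m + gu_min] := EVT_min (ltW hT) (ac_continuous gu_ac).
rewrite in_itv /= => /u_gt0/g_gt0 gum0.
pose w s := (nu * g s)^-1.
have nugu_ac : absolutely_continuous_on 0 T (fun x => nu * g (u x)).
  apply: (@lipschitz_ac _ _ _ (nu * (K * D))) => x y x0 xy yT.
  by rewrite -mulrBr normrM gtr0_norm// -mulrA ler_pM2l// gu_lip.
have nugu_min x : 0 <= x <= T -> nu * g (u m) <= nu * g (u x).
  by move=> xT; rewrite ler_pM2l//; apply: gu_min; rewrite in_itv.
have num0 : 0 < nu * g (u m) by exact: mulr_gt0.
have w_ac := acV num0 nugu_min nugu_ac.
have w_le x : 0 <= x <= T -> `|w (u x)| <= w (u m).
  move=> xT; have := nugu_min _ xT => le_m.
  have gx0 := lt_le_trans num0 le_m.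
  by rewrite /w gtr0_norm ?invr_gt0// lef_pV2.
pose z x := du x * w (u x).
have z_ac : absolutely_continuous_on 0 T z by exact: acM duD w_le du_ac w_ac.
have [t0 t0T du0] := boundary_operator0_zero hT udu bc0.
have zt0 : z t0 = 0 by rewrite /z du0 mul0r.
have zT : z T = z 0 := boundary_operator0_quotient w bc0.
have zA : {ae @lebesgue_measure R, forall x, 0 < x < T ->
    [/\ derivable z x 1, derivable A x 1 &
        `|derive1 z x + derive1 A x| <= nu * K * z x ^+ 2]}.
  have aeF := ae_filter_ringOfSetsType (@lebesgue_measure R).
  move: ode (indefinite_integral_ae_derive intf); apply: filterS2.
  move=> x odex [dA Ax] /andP[x0 xT].
  have xT' : 0 <= x <= T by rewrite !ltW.
  have [|ddu {}odex] := odex; first by rewrite in_itv.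
  have ux0 := u_gt0 _ xT'.
  have ux : is_derive x 1 u (du x).
    by apply: derive_on_is_derive udu _ _; rewrite x0.
  have dz : is_derive x 1 z _ := derive_quotient nu0 (g_gt0 _ ux0) ux
    (g_derivable _ ux0) ddu odex.
  split=> //.
  (* On [[0, T]] the function [f] is [a], so it cancels the [- a x] of the Riccati equation and only
     the quadratic term remains. *)
  rewrite Ax derive1E derive_val /f patchE mem_set ?in_itv//=.
  rewrite addrAC addNr add0r normrN -[du x * _]/(z x).
  rewrite normrM [`|_ ^+ 2|]ger0_norm ?sqr_ge0// ler_wpM2r ?sqr_ge0//.
  rewrite normrM (gtr0_norm nu0).
  by rewrite ler_pM2l// gK.
have bnd : nu * K * (2 * L + 1) ^+ 2 * T <= nu * C.
  by rewrite /C -!mulrA ler_pM2l// lerDl.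
have nuK0 : 0 <= nu * K by rewrite mulr_ge0// ltW.
have := riccati_bound hT nuK0 z_ac (indefinite_integral_ac intf 0 T)
  (indefinite_integral_dist_le intf) zA t0T zt0 (le_lt_trans bnd nuL).
(* Because [z T = z 0], the bound falls on the increment of [A] alone:
   [A 0 - A T <= nu * C < A 0 - A T]. *)
rewrite -/(A T) -/(A 0) zT.
have -> : z 0 + A T - (z 0 + A 0) = A T - A 0 by ring.
rewrite ltr0_norm// opprB => /le_trans/(_ bnd)/le_lt_trans/(_ nuA).
by rewrite ltxx.
Qed.
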